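(* Let $F(n)$ denote the number of unordered factorizations of a positive integer $n$ into pairwise coprime integers larger than one, and let $L(x) = \exp(\log x \log_3 x/\log_2 x)$. For every fixed $\beta > 1$, as $x \to \infty$, \[\sum_{n \leq x} F(n)^\beta = \frac{x^\beta}{L(x)^{2\beta + o(1)}}.\]
   Context: $\log_k$ denotes the $k$-th iterate of the natural logarithm. *)

(* Defs.v *)
From mathcomp Require Import all_boot all_order all_algebra.
From mathcomp Require Import all_classical all_reals all_analysis.
Set Implicit Arguments.
Unset Strict Implicit.
Unset Printing Implicit Defensive.
Import Order.TTheory GRing.Theory Num.Theory.
Import numFieldNormedType.Exports.
Local Open Scope ring_scope.

(* An unordered factorization is a finite multiset of factors, represented by
   its unique weakly increasing enumeration. *)
Definition coprime_factorization (n : nat) (s : seq nat) : bool :=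
  [&& sorted leq s, all (ltn 1) s, pairwise coprime s
    & (\prod_(d <- s) d)%N == n].

(* The bounds n on the length and n.+1 on the entries only make the type
   finite: by [coprime_factorization_bounded] they exclude nothing if n > 0.
   The empty factorization is allowed, so F 1 = 1. *)
Definition F (n : nat) : nat :=
  #|[pred t : n.-bseq 'I_n.+1
      | coprime_factorization n [seq nat_of_ord i | i <- t]]|.

Lemma coprime_factorization_bounded (n : nat) (s : seq nat) :
  (0 < n)%N -> coprime_factorization n s ->
  exists t : n.-bseq 'I_n.+1, [seq nat_of_ord i | i <- t] = s.
Proof.
move=> n0 /and4P[_ s1 _ /eqP sn].
have sz : (size s <= n)%N.
  suff: (size s < n.+1)%N by [].
  rewrite -{}sn ltnS; elim: s s1 => [|d s IH] //= /andP[d1 s1].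
  have s0 : (0 < \prod_(j <- s) j)%N.
    elim: (s) s1 => [|e s' IH'] /=; first by rewrite big_nil.
    by case/andP=> e1 /IH' s'0; rewrite big_cons muln_gt0 (ltnW e1).
  by rewrite big_cons (leq_ltn_trans (IH s1)) // ltn_Pmull.
have sb : all (fun d => d < n.+1)%N s.
  apply/allP => d ds; rewrite ltnS dvdn_leq// -sn.
  by rewrite (big_rem d)//= dvdn_mulr.
have st : [seq nat_of_ord i | i <- [seq inord d | d <- s] : seq 'I_n.+1] = s.
  rewrite -map_comp -[RHS]map_id; apply/eq_in_map => d /(allP sb) dn /=.
  by rewrite inordK.
have szt : (size [seq inord d : 'I_n.+1 | d <- s] <= n)%N by rewrite size_map.
by exists (Bseq szt).
Qed.

Definition logk (R : realType) (k : nat) (x : R) : R := iter k (@ln R) x.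

Definition L (R : realType) (x : R) : R :=
  expR (ln x * logk 3 x / logk 2 x).

(* Main.v *)
(** F(n) is the Bell number of k = omega(n); up to exp(O(k)) it equals
    (k / log k)^k.

    Lower bound: by Chebyshev there is n <= x which is a product of
    k ~ log x / log_2 x distinct primes of size O(log x). Fixing j ~ k / log k of
    them as leaders and attaching each other prime to a leader yields j^(k-j)
    factorizations, and j^(k-j) = x / L(x)^(2+o(1)).

    Upper bound: fix s with 1 < s < beta. Rankin's trick with the weight
    t^omega(n) n^(-s), t = (k log k)^s, together with Chebyshev's upper bound
    shows that the sum of n^(-s) over omega(n) = k is at most
    A_k^(-s) exp(O(k)), A_k = (k log k)^k. So the n <= x with omega(n) = k
    contribute at most
      x^s (k / log k)^(beta k) A_k^(-s) exp(O(k))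
        = x^beta (log k)^(-2 beta k) (A_k / x)^(beta - s) exp(O(k)),
    and there are none unless A_k <= x exp(O(k)). If k is close to
    log x / log_2 x the factor (log k)^(-2 beta k) is L(x)^(-2 beta + o(1));
    otherwise A_k / x is at most a negative power of x. *)

Require Import Defs.
From mathcomp Require Import all_boot fingroup.perm zify.
Set Implicit Arguments.
Unset Strict Implicit.
Unset Printing Implicit Defensive.

(** * Chebyshev's estimates *)

Definition primepi (n : nat) : nat := count prime (iota 1 n).

Lemma primepiS n : primepi n.+1 = primepi n + prime n.+1.
Proof. by rewrite /primepi -{1}(addn1 n) iotaD count_cat /= addn0 add1n. Qed.

Lemma primepi_leq n : primepi n <= n.
Proof. by rewrite /primepi (leq_trans (count_size _ _)) ?size_iota. Qed.

Lemma leq_size_primepi (s : seq nat) n :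
  uniq s -> (forall p, p \in s -> prime p /\ p <= n) -> size s <= primepi n.
Proof.
move=> us hs; rewrite /primepi -size_filter; apply: uniq_leq_size => // p ps.
have [pp pn] := hs p ps.
by rewrite mem_filter pp mem_iota prime_gt0//= add1n ltnS.
Qed.

Lemma prod_primes_dvd a b N :
  (forall p, prime p -> a <= p < b -> p %| N) ->
  \prod_(a <= p < b | prime p) p %| N.
Proof.
have [ba _|ab] := leqP b a; first by rewrite big_geq ?dvd1n.
elim: b ab => // b IH; rewrite ltnS leq_eqVlt => /predU1P[<-|ab] hN.
  rewrite big_mkcond big_nat1; case: ifP => // pa.
  by rewrite hN// leqnn ltnSn.
have IHb : \prod_(a <= p < b | prime p) p %| N.
  apply: IH => // p pp /andP[ap pb]; apply: hN => //.
  by rewrite ap (ltn_trans pb).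
rewrite big_mkcond big_nat_recr ?(ltnW ab)//= -big_mkcond /=.
case: ifP => pb; last by rewrite muln1.
rewrite Gauss_dvd ?IHb/= ?hN ?(ltnW ab) ?ltnSn//.
rewrite coprime_sym big_nat_cond; elim/big_ind : _ => [|x y hx hy|p].
- exact: coprimen1.
- by rewrite coprimeMr hx hy.
- case/andP => /andP[ap pb'] pp.
  by rewrite prime_coprime// dvdn_prime2// neq_ltn pb' orbT.
Qed.

Lemma prime_dvd_fact p n : prime p -> (p %| n`!) = (p <= n).
Proof.
move=> pp; apply/idP/idP; last by move=> pn; rewrite dvdn_fact// prime_gt0.
elim: n => [|n IH]; first by rewrite fact0 dvdn1; case: p pp => [|[]].
rewrite factS Euclid_dvdM// => /orP[/dvdn_leq -> //|/IH].
by move=> /leq_trans; apply.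
Qed.

(** The two equal middle entries of row 2m+1 of Pascal's triangle add up to at most the row sum
    2^(2m+1). *)
Lemma bin_odd_center_ub m : 'C(m.*2.+1, m) <= 4 ^ m.
Proof.
have h : 'C(m.*2.+1, m) + 'C(m.*2.+1, m.+1) <= 2 ^ m.*2.+1.
  have -> : 2 ^ m.*2.+1 = \sum_(i < m.*2.+2) 'C(m.*2.+1, i).
    rewrite (expnDn 1 1); apply: eq_bigr => i _.
    by rewrite !exp1n !muln1.
  have mlt : m < m.*2.+2 by lia.
  have m1lt : m.+1 < m.*2.+2 by lia.
  rewrite (bigD1 (Ordinal mlt))//= (bigD1 (Ordinal m1lt))//=.
    by rewrite addnA leq_addr.
  by rewrite -val_eqE /=; lia.
have e : 'C(m.*2.+1, m.+1) = 'C(m.*2.+1, m).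
  by rewrite -bin_sub; [congr binomial|]; lia.
move: h; rewrite e addnn -mul2n expnS leq_pmul2l//.
by rewrite -muln2 mulnC expnM.
Qed.

(** Erdős's induction: an even n > 2 is not prime, and for n = 2m+1 the primes in [m+2, 2m+1] all
    divide C(2m+1, m) <= 4^m, while the smaller ones are covered by the case m+1. *)
Lemma primorial_ub n : \prod_(1 <= p < n.+1 | prime p) p <= 4 ^ n.
Proof.
elim/ltn_ind: n => n IH.
case: (leqP n 2) => [n2|n2].
  case: n n2 {IH} => [|[|[|//]]] _; first by rewrite big_geq.
    by rewrite big_mkcond big_nat1.
  by rewrite big_mkcond big_nat_recr//= big_nat1.
have [on|en] := boolP (odd n); last first.
  case: n IH n2 en => // n IH n2 en.
  rewrite big_mkcond big_nat_recr//= ifF; last first.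
    apply/negP => /even_prime[|]; first by lia.
    by rewrite (negPf en).
  rewrite muln1 -big_mkcond (leq_trans (IH _ _))// leq_exp2l//.
pose m := n./2.
have nE : n = m.*2.+1 by rewrite -[LHS]odd_double_half on.
rewrite nE (@big_cat_nat _ _ _ m.+2)//=; last by rewrite ltnS -addnn leq_addr.
have -> : 4 ^ m.*2.+1 = 4 ^ m.+1 * 4 ^ m by rewrite -expnD; congr expn; lia.
apply: leq_mul; first by apply: IH; lia.
apply: leq_trans (bin_odd_center_ub m).
apply: dvdn_leq; first by rewrite bin_gt0; lia.
apply: prod_primes_dvd => p pp /andP[mp pm].
have : p %| (m.*2.+1)`! by rewrite prime_dvd_fact//; lia.
have mle : m <= m.*2.+1 by lia.
rewrite -(bin_fact mle) Euclid_dvdM// Euclid_dvdM// !prime_dvd_fact//.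
by case/or3P => //; lia.
Qed.

(** The k-th prime is at least k, so the primorial dominates the factorial of pi(n). This form of
    Chebyshev's upper bound avoids logarithms. *)
Lemma fact_primepi_ub n : (primepi n)`! <= 4 ^ n.
Proof.
apply: leq_trans (primorial_ub n).
elim: n => [|n IH]; first by rewrite big_geq.
rewrite primepiS big_mkcond big_nat_recr//= -big_mkcond /=.
case: ifP => pn; last by rewrite addn0 muln1.
by rewrite addn1 factS mulnC leq_mul// ltnS primepi_leq.
Qed.

(** By Legendre's formula the exponent is the sum over k of floor(2n/p^k) - 2 floor(n/p^k); each
    term is at most 1 and vanishes once p^k > 2n. *)
Lemma logn_bin_center p n : prime p -> 0 < n ->
  logn p 'C(n.*2, n) <= trunc_log p n.*2.
Proof.
move=> pp n0; set T := trunc_log _ _.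
have nle : n <= n.*2 by lia.
have := congr1 (logn p) (bin_fact nle).
have -> : n.*2 - n = n by lia.
rewrite lognM ?bin_gt0 ?muln_gt0 ?fact_gt0// lognM ?fact_gt0//.
rewrite !logn_fact// => E.
(* Zero terms stretch Legendre's sum for n! to k <= 2n, the range of the sum for (2n)!. *)
have ext : \sum_(1 <= k < n.+1) n %/ p ^ k = \sum_(1 <= k < n.*2.+1) n %/ p ^ k.
  rewrite [RHS](@big_cat_nat _ _ _ n.+1)//=.
  rewrite [X in _ = _ + X](_ : _ = 0) ?addn0//.
  rewrite big_nat_cond big1// => k /andP[/andP[nk _] _].
  by rewrite divn_small// (leq_trans (ltn_expl n (prime_gt1 pp)))// leq_exp2l ?prime_gt1// ltnW.
have bnd : \sum_(1 <= k < n.*2.+1) n.*2 %/ p ^ k <=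
    \sum_(1 <= k < n.*2.+1) (n %/ p ^ k + n %/ p ^ k + (k <= T)).
  apply: leq_sum => k _; have pk : 0 < p ^ k by rewrite expn_gt0 prime_gt0.
  have [kT|Tk] := leqP k T; first by rewrite -addnn leq_divDl.
  rewrite divn_small//; apply: leq_trans (trunc_log_ltn _ (prime_gt1 pp)) _.
  by rewrite leq_exp2l ?prime_gt1.
move: bnd; rewrite !big_split /= -ext -E addnC leq_add2l => /leq_trans; apply.
have [Tn|Tn] := leqP T n.*2.
  rewrite (@big_cat_nat _ _ _ T.+1)//= [X in _ + X <= _](_ : _ = 0) ?addn0.
    apply: leq_trans (_ : \sum_(1 <= k < T.+1) 1 <= _).
      by apply: leq_sum => k _; exact: leq_b1.
    by rewrite sum_nat_const_nat muln1 subn1.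
  by rewrite big_nat_cond big1// => k /andP[/andP[Tk _] _]; rewrite leqNgt Tk.
apply: leq_trans (_ : \sum_(1 <= k < n.*2.+1) 1 <= _).
  by apply: leq_sum => k _; exact: leq_b1.
by rewrite sum_nat_const_nat muln1 subn1 /= ltnW.
Qed.

(** Each prime power in C(2n, n) is at most 2n, and only primes up to 2n occur. *)
Lemma bin_center_ub n : 0 < n -> 'C(n.*2, n) <= n.*2 ^ primepi n.*2.
Proof.
move=> n0; set B := 'C(_, _).
have B0 : 0 < B by rewrite bin_gt0; lia.
rewrite (prod_prime_decomp B0) prime_decompE big_map /=.
have szB : size (primes B) <= primepi n.*2.
  apply: leq_size_primepi; first exact: primes_uniq.
  move=> p; rewrite mem_primes => /and3P[pp _ pB]; split => //.
  rewrite -prime_dvd_fact//.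
  have nle : n <= n.*2 by lia.
  by rewrite -(bin_fact nle) dvdn_mulr.
apply: (@leq_trans (n.*2 ^ size (primes B))); last by rewrite leq_pexp2l//; lia.
rewrite -sum1_size expn_sum big_seq [X in _ <= X]big_seq; apply: leq_prod => p.
rewrite mem_primes => /and3P[pp _ pB]; rewrite expn1.
apply: leq_trans (_ : p ^ trunc_log p n.*2 <= _).
  by rewrite leq_pexp2l ?prime_gt0// logn_bin_center.
by rewrite trunc_logP ?prime_gt1//; lia.
Qed.

(** Successive central coefficients have ratio 2(2n+1)/(n+1) >= 2. *)
Lemma bin_center_lb n : 2 ^ n <= 'C(n.*2, n).
Proof.
elim: n => // n IH.
have : n.+1 * 'C(n.+1.*2, n.+1) = (n.*2.+1).*2 * 'C(n.*2, n).
  have h1 := mul_bin_diag n.*2.+2 n.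
  have h2 := mul_bin_down n.*2.+1 n.
  rewrite /= in h1 h2.
  have e : n.*2.+1 - n = n.+1 by lia.
  rewrite e in h2.
  apply/eqP; rewrite -(eqn_pmul2l (ltn0Sn n)); apply/eqP.
  rewrite doubleS -h1; move: h2; nia.
by rewrite expnS; nia.
Qed.

Lemma exp2_primepi_lb n : 0 < n -> 2 ^ n <= n.*2 ^ primepi n.*2.
Proof. by move=> n0; rewrite (leq_trans (bin_center_lb n)) ?bin_center_ub. Qed.

(** * Counting factorizations *)

Section Blocks.
Variables (n : nat) (s : seq nat).
Hypothesis (hs : coprime_factorization n s).

Lemma factors_gt1 d : d \in s -> 1 < d.
Proof. by case/and4P: hs => _ /allP h _ _ /h. Qed.

Lemma factors_uniq : uniq s.
Proof.
case/and4P: hs => _ s1 sc _; rewrite uniq_pairwise.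
apply: sub_in_pairwise s1 sc => x y; rewrite !inE => x1 y1 /= xy.
by apply/eqP => exy; move: xy x1; rewrite -exy /coprime gcdnn => /eqP ->.
Qed.

(** By coprimality a prime divides at most one factor, so the first one found is the only one. *)
Lemma find_factor p l : prime p -> l < size s -> p %| nth 0 s l ->
  find (dvdn p) s = l.
Proof.
move=> pp ls pl; case/and4P: hs => _ s1 /(pairwiseP 0) sc _.
have fs : find (dvdn p) s < size s.
  by rewrite -has_find; apply/hasP; exists (nth 0 s l) => //; rewrite mem_nth.
have pf : p %| nth 0 s (find (dvdn p) s) by apply: nth_find; rewrite has_find.
apply/eqP; rewrite eqn_leq leqNgt; apply/andP; split.
  by apply/negP => /(before_find 0); rewrite pl.
rewrite leqNgt; apply/negP => fl; have := sc _ _ fs ls fl.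
move=> /(coprime_dvdl pf) /(coprime_dvdr pl).
by rewrite prime_coprime// dvdnn.
Qed.

(** Taking the part at these primes keeps the i-th factor whole and reduces every other factor to 1.
    Hence a factorization can be recovered from the map sending primes to positions. *)
Lemma factor_partn i : i < size s ->
  nth 0 s i = n`_[pred p | find (dvdn p) s == i].
Proof.
move=> si; set P := [pred p | _].
have -> : n`_P = \prod_(d <- s) d`_P.
  case/and4P: hs => _ s1 _ /eqP <-; elim: (s) s1 => [|d s' IH] /=.
    by rewrite !big_nil partn1.
  case/andP => d1 s1; rewrite !big_cons partnM ?IH//; first exact: ltnW.
  elim: (s') s1 {IH} => [|e s'' IH] /=; first by rewrite big_nil.
  by case/andP=> e1 /IH h; rewrite big_cons muln_gt0 (ltnW e1).
rewrite (big_nth 0) big_mkord (bigD1 (Ordinal si))//= big1 => [|l li].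
  rewrite muln1 part_pnat_id//; apply/pnatP.
    by rewrite (ltnW (factors_gt1 _))// mem_nth.
  by move=> p pp pd; rewrite !inE /= (find_factor pp si pd).
rewrite part_p'nat//; apply/pnatP.
  by rewrite (ltnW (factors_gt1 _))// mem_nth.
move=> p pp pd; rewrite !inE /= (find_factor pp (ltn_ord l) pd).
by apply: contra li => /eqP li; apply/eqP/val_inj.
Qed.

Lemma find_factor_lt p : p \in primes n -> find (dvdn p) s < size s.
Proof.
rewrite mem_primes => /and3P[pp _]; rewrite -has_find.
case/and4P: hs => _ _ _ /eqP <-; elim: (s) => [|d s' IH] /=.
  by rewrite big_nil dvdn1 => /eqP p1; rewrite p1 in pp.
by rewrite big_cons Euclid_dvdM// => /orP[->//|/IH ->]; rewrite orbT.
Qed.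

End Blocks.

Lemma coprime_factorization_eq n m s s' : coprime_factorization n s ->
  coprime_factorization m s' -> s =i s' -> s = s'.
Proof.
move=> hs hs' ss'; apply: (sorted_eq leq_trans anti_leq).
- by case/and4P: hs.
- by case/and4P: hs'.
- by apply: uniq_perm => //; [apply: factors_uniq hs|apply: factors_uniq hs'].
Qed.

Definition factorizations_of_length n j : {set n.-bseq 'I_n.+1} :=
  [set t : n.-bseq 'I_n.+1 | coprime_factorization n [seq nat_of_ord i | i <- t]
           & size t == j].

Lemma F_sum_length n :
  F n = \sum_(j < n.+1) #|factorizations_of_length n j|.
Proof.
rewrite /F -sum1_card.
rewrite (partition_big (fun t : n.-bseq 'I_n.+1 => inord (size t) : 'I_n.+1) xpredT)//=.
apply: eq_bigr => j _; rewrite -sum1_card; apply: eq_bigl => t.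
rewrite !inE; congr andb; rewrite -val_eqE /= inordK// ltnS.
exact: size_bseq.
Qed.

(* Numbering the factors in any of the [j!] orders yields a map from the primes
   of [n] to ['I_j], and the factorization and the order can be read off it. *)
Lemma card_factorizations_of_length n j : 0 < n ->
  #|factorizations_of_length n j| * j`! <= j ^ size (primes n).
Proof.
move=> n0; case: j => [|j].
  rewrite fact0 muln1.
  (* For j = 0 the right side is 0^omega(n): it is 1 for n = 1, which has the empty factorization,
     and 0 for n > 1, which has no factorization of length 0. *)
  have [n1|n1] := leqP n 1.
    have -> : n = 1 by apply/eqP; rewrite eqn_leq n1.
    rewrite expn0; apply/card_le1_eqP => t t'; rewrite !inE.
    by case/andP => _ /nilP t0 /andP[_ /nilP t0']; apply/val_inj; rewrite /= t0 t0'.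
  rewrite exp0n; last by rewrite lt0n size_eq0 primes_eq0 -leqNgt.
  rewrite leqn0 cards_eq0 -subset0; apply/fintype.subsetP => t; rewrite !inE.
  case/andP => /and4P[_ _ _ pr] /nilP t0; move: pr.
  by rewrite t0 big_nil => /eqP n1'; rewrite -n1' in n1.
pose k := size (primes n).
pose sq (t : n.-bseq 'I_n.+1) := [seq nat_of_ord i | i <- t].
(* The a-th prime of n is sent to the number, under the permutation, of the factor that it
   divides. *)
pose phi (x : n.-bseq 'I_n.+1 * {perm 'I_j.+1}) : {ffun 'I_k -> 'I_j.+1} :=
  [ffun a : 'I_k => x.2 (inord (find (dvdn (nth 0 (primes n) a)) (sq x.1)))].
(* The factor numbered i is the part of n at the primes that [phi x] sends to i, so it depends on
   [phi x] alone. *)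
have key x i : x.1 \in factorizations_of_length n j.+1 ->
    nth 0 (sq x.1) (((x.2^-1)%g : {perm 'I_j.+1}) i) =
    n`_[pred p | if (insub (index p (primes n)) : option 'I_k) is Some a
                 then phi x a == i else false].
  case: x => t s /=; rewrite inE => /andP[ht /eqP st].
  rewrite (factor_partn ht) ?size_map ?st//.
  apply: eq_in_partn => p; rewrite !inE -/(primes n) => pn.
  have ip : index p (primes n) < k by rewrite index_mem.
  rewrite insubT /= ffunE /= nth_index//.
  have fl := find_factor_lt ht pn.
  rewrite size_map st in fl.
  rewrite (can2_eq (permK s) (permKV s)) -val_eqE /= inordK//.
have inj : {in setX (factorizations_of_length n j.+1) [set: {perm 'I_j.+1}] &,
    injective phi}.
  move=> [t s] [t' s']; rewrite !inE !andbT => tj tj' E.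
  have E' i : nth 0 (sq t) (((s^-1)%g : {perm 'I_j.+1}) i) = nth 0 (sq t') (((s'^-1)%g : {perm 'I_j.+1}) i).
    have /= -> := @key (t, s) i; last by rewrite inE.
    have /= -> := @key (t', s') i; last by rewrite inE.
    by apply: eq_partn => p; rewrite !inE E.
  case/andP: tj tj' => ht /eqP st /andP[ht' /eqP st'].
  have sst : size (sq t) = j.+1 by rewrite size_map.
  have sst' : size (sq t') = j.+1 by rewrite size_map.
  (* Running over all numbers i gives equal sets of factors, hence equal sorted lists. *)
  have tt' : sq t = sq t'.
    apply: (coprime_factorization_eq ht ht') => x; apply/idP/idP.
      move=> /(nthP 0)[l]; rewrite sst => lj <-.
      have := E' (s (Ordinal lj)); rewrite permK /= => ->.
      by rewrite mem_nth// sst'.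
    move=> /(nthP 0)[l]; rewrite sst' => lj <-.
    have := E' (s' (Ordinal lj)); rewrite permK /= => <-.
    by rewrite mem_nth// sst.
  congr pair; first by apply/val_inj/(inj_map (@ord_inj _)).
  (* As the factors are distinct, equal factors at every number force equal permutations. *)
  apply: invg_inj; apply/permP => i; apply/val_inj/eqP.
  have := E' i; rewrite -tt' => /eqP.
  by rewrite nth_uniq ?sst//; exact: factors_uniq ht.
have := leq_card_in _ _ inj.
by rewrite cardsX cardsT card_Sn card_ffun !card_ord.
Qed.

(** The [u i] act as leaders: a map f from the [v l] to the leaders gives the factorization whose
    i-th factor is [u i] times the [v l] with f l = i. The factor containing [v l] reveals its
    leader, so different maps give different factorizations. *)
Lemma F_prod_primes_lb j m (u : 'I_j -> nat) (v : 'I_m -> nat) :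
  (forall i, prime (u i)) -> (forall l, prime (v l)) ->
  injective u -> injective v -> (forall i l, u i != v l) ->
  j ^ m <= F ((\prod_i u i) * \prod_l v l).
Proof.
move=> pu pv iu iv uv; set n := _ * _.
have n0 : 0 < n by rewrite muln_gt0 !prodn_gt0// => ?; rewrite prime_gt0.
pose c (f : {ffun 'I_m -> 'I_j}) i := u i * \prod_(l | f l == i) v l.
have dvdc p f i : prime p -> p %| c f i ->
    p = u i \/ exists2 l, f l = i & p = v l.
  move=> pp; rewrite Euclid_dvdM// dvdn_prime2// => /orP[/eqP ->|]; first by left.
  move=> h; right; move: h; elim/big_rec : _ => [|l y /eqP fl IH].
    by rewrite dvdn1 => /eqP p1; rewrite p1 in pp.
  by rewrite Euclid_dvdM// dvdn_prime2// => /orP[/eqP ->|/IH//]; exists l.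
have c1 f i : 1 < c f i.
  apply: leq_trans (prime_gt1 (pu i)) _.
  by rewrite leq_pmulr// prodn_cond_gt0// => l _; rewrite prime_gt0.
have cc f i i' : i != i' -> coprime (c f i) (c f i').
  move=> ii'; rewrite coprime_has_primes ?(ltnW (c1 _ _))//.
  apply/hasPn => p; rewrite !mem_primes => /and3P[pp _ p2].
  rewrite pp (ltnW (c1 _ _)) /=; apply/negP => p1; move/eqP: ii'; apply.
  case: (dvdc _ _ _ pp p1) (dvdc _ _ _ pp p2) => [->|[l <- ->]] [|[l' <-]].
  - exact: iu.
  - by move=> e; have := uv i l'; rewrite e eqxx.
  - by move=> e; have := uv i' l; rewrite e eqxx.
  - by move=> /iv ->.
pose s f := sort leq [seq c f i | i <- enum 'I_j].
have memc f i : c f i \in s f by rewrite mem_sort map_f ?mem_enum.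
have inj_c f : injective (c f).
  move=> i i' e; apply/eqP/negP => /negP /(cc f).
  by rewrite e /coprime gcdnn gtn_eqF.
have hs f : coprime_factorization n (s f).
  apply/and4P; split.
  - exact: sort_sorted leq_total _.
  - by rewrite all_sort; apply/allP => _ /mapP[i _ ->]; exact: c1.
  - have us : uniq (s f) by rewrite sort_uniq map_inj_uniq ?enum_uniq.
    move: (us); rewrite uniq_pairwise; apply: sub_in_pairwise (allss _).
    move=> x y; rewrite !mem_sort => /mapP[i _ ->] /mapP[i' _ ->] /= e.
    by apply: cc; apply: contra e => /eqP ->.
  - rewrite (perm_big _ (permEl (perm_sort _ _))) big_map big_enum big_split /=.
    by rewrite /n [X in _ == _ * X](partition_big f xpredT).
have ex f : exists t : n.-bseq 'I_n.+1, [seq nat_of_ord i | i <- t] == s f.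
  by have [t ht] := coprime_factorization_bounded n0 (hs f); exists t; apply/eqP.
pose g f := xchoose (ex f).
have hg f : [seq nat_of_ord i | i <- g f] = s f by apply/eqP; exact: xchooseP (ex f).
have gs f f' : s f = s f' -> f = f'.
  move=> e; apply/ffunP => l; set i := f l.
  have : c f i \in s f' by rewrite -e.
  rewrite mem_sort => /mapP[i' _ ci].
  have : u i %| c f' i' by rewrite -ci dvdn_mulr.
  move=> /(dvdc _ _ _ (pu i))[/iu ii'|[l' _ e']]; last first.
    by have := uv i l'; rewrite e' eqxx.
  have : v l %| c f' i' by rewrite -ci dvdn_mull// (bigD1 l)//= dvdn_mulr.
  move=> /(dvdc _ _ _ (pv l))[e'|[l' fl' /iv ll']].
    by have := uv i' l; rewrite e' eqxx.
  by rewrite -/i ii' -fl' ll'.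
have inj_g : injective g by move=> f f' e; apply: gs; rewrite -!hg e.
have -> : j ^ m = #|[set g f | f in {ffun 'I_m -> 'I_j}]|.
  by rewrite card_imset// card_ffun !card_ord.
apply: subset_leq_card; apply/fintype.subsetP => _ /imsetP[f _ ->].
by rewrite unfold_in /= hg.
Qed.

From mathcomp Require Import all_order all_algebra.
From mathcomp Require Import all_classical all_reals all_analysis.
From mathcomp Require Import ring lra.
Import Order.TTheory GRing.Theory Num.Theory.
Import numFieldNormedType.Exports.
Local Open Scope ring_scope.

(** * Real bounds for pi(n) and F(n) *)

Section RealBounds.
Variable R : realType.
Implicit Types (x : R) (k n : nat).

Lemma powR_expR x s : 0 < x -> x `^ s = expR (s * ln x).
Proof. by move=> x0; rewrite /powR gt_eqF. Qed.

Lemma exprn_expR x n : 0 < x -> x ^+ n = expR (n%:R * ln x).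
Proof. by move=> x0; rewrite expRM_natl lnK. Qed.

Lemma le_ln x y : 0 < x -> x <= y -> ln x <= ln y.
Proof. by move=> x0 xy; rewrite ler_ln// posrE// (lt_le_trans x0). Qed.

Lemma lnM_gt0 x y : 0 < x -> 0 < y -> ln (x * y) = ln x + ln y.
Proof. by move=> x0 y0; rewrite lnM. Qed.

Lemma ln_leB1 x : 0 < x -> ln x <= x - 1.
Proof.
move=> x0; have := @le_ln1Dx R (x - 1); rewrite [1 + _]addrC subrK; apply; lra.
Qed.

Lemma ln_ge1B x : 0 < x -> 1 - x^-1 <= ln x.
Proof.
move=> x0; have := @ln_leB1 x^-1; rewrite invr_gt0 lnV// => /(_ x0); lra.
Qed.

Lemma ler_term_expR x n : 0 <= x -> x ^+ n / n`!%:R <= expR x.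
Proof.
move=> x0; case: n => [|n].
  by rewrite expr0 fact0 divr1 -[1]addr0 (le_trans _ (expR_ge1Dx x))// lerD2l.
by rewrite (le_trans _ (expR_ge1Dxn n x0))// lerDr.
Qed.

Lemma exprn_le_fact x n : 0 <= x -> x ^+ n <= n`!%:R * expR x.
Proof.
by move=> /(ler_term_expR n); rewrite ler_pdivrMr ?ltr0n ?fact_gt0// mulrC.
Qed.

Lemma sum_expR_ub x n : 0 <= x -> \sum_(j < n) x ^+ j / j`!%:R <= expR x.
Proof.
move=> x0; have := @is_cvg_series_exp_coeff R x.
have -> : \sum_(j < n) x ^+ j / j`!%:R = series (exp_coeff x) n.
  by rewrite /series /= big_mkord; apply: eq_bigr => j _; rewrite /exp_coeff /=.
move=> cv; apply: nondecreasing_cvgn_le => //.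
by apply: nondecreasing_series => i _ _; rewrite /exp_coeff /= divr_ge0// exprn_ge0.
Qed.

(** The shift by 3 keeps the logarithm at least 1/2 for every k, so that it can be divided by and
    its own logarithm is bounded below. *)
Definition lnD3 (k : nat) : R := ln (k%:R + 3).

Lemma lnD3_ge k : 1 / 2 <= lnD3 k.
Proof.
apply: le_trans (ln_ge1B _); last by rewrite ltr_wpDl.
have : (k%:R + 3)^-1 <= 2^-1 :> R.
  have k0 : 0 <= k%:R :> R by [].
  by rewrite lef_pV2 ?posrE//; lra.
lra.
Qed.

Lemma lnD3_gt0 k : 0 < lnD3 k.
Proof. by have := lnD3_ge k; lra. Qed.

(** With m = pi(n), m! <= 4^n and m^m <= m! e^m give m ln m <= n ln 4 + m. Passing to ln (m+3) <= ln
    4 + ln m costs another m ln 4; since ln 4 <= 3 and m <= n, the total constant is 3 + 1 + 3 =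
    7. *)
Lemma primepi_lnD3_ub n :
  (primepi n)%:R * lnD3 (primepi n) <= 7 * n%:R.
Proof.
have hm := primepi_leq n; move: (fact_primepi_ub n) hm.
set m := primepi n => hf hm.
have [->|m0] := posnP m; first by rewrite mul0r mulr_ge0.
have mR : 1 <= m%:R :> R by rewrite ler1n.
have mn : m%:R <= n%:R :> R by rewrite ler_nat.
have l4 : ln 4 <= 3 :> R by have := @ln_leB1 4; lra.
have l4m : lnD3 m <= ln 4 + ln m%:R.
  by rewrite -lnM_gt0//; [apply: le_ln; lra|lra].
have : m%:R ^+ m <= 4 ^+ n * expR m%:R :> R.
  apply: le_trans (exprn_le_fact _ _) _; first lra.
  by rewrite ler_pM2r ?expR_gt0// -natrX ler_nat.
rewrite !exprn_expR; [|lra..].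
rewrite -expRD ler_expR => h.
have : m%:R * lnD3 m <= m%:R * (ln 4 + ln m%:R).
  by rewrite ler_wpM2l//; lra.
have : n%:R * ln 4 <= n%:R * 3 :> R by rewrite ler_wpM2l.
have : m%:R * ln 4 <= m%:R * 3 :> R by rewrite ler_wpM2l.
rewrite mulrDr; lra.
Qed.

Lemma primepi_lb n : (0 < n)%N ->
  n%:R / 2 <= (primepi n.*2)%:R * ln n.*2%:R :> R.
Proof.
move=> n0; have := exp2_primepi_lb n0; rewrite -(ler_nat R) !natrX.
rewrite !exprn_expR ?ltr0n ?double_gt0// ler_expR => h.
have l2 : 1 / 2 <= ln 2 :> R by have := @ln_ge1B 2; lra.
have : n%:R * (1 / 2) <= n%:R * ln 2 :> R by rewrite ler_wpM2l.
lra.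
Qed.

(* With r = ln (k+3), bound j^k by k! exp(j r) / r^k and sum over j. *)
Lemma F_ub n (k := size (primes n)) : (0 < n)%N ->
  (F n)%:R <= expR 3 * (expR 1 * k%:R / lnD3 k) ^+ k.
Proof.
move=> n0; set r := lnD3 k; have r0 : 0 < r by exact: lnD3_gt0.
(* Since e^r = k+3, the terms e^(jr) / j! belong to the series of e^(k+3). *)
have Er : expR r = k%:R + 3 by rewrite /r /lnD3 lnK// posrE ltr_wpDl.
have h : (F n)%:R <= k`!%:R / r ^+ k * expR (k%:R + 3).
  have st : (F n)%:R <= \sum_(j < n.+1) (k`!%:R / r ^+ k) * ((k%:R + 3) ^+ j / j`!%:R).
    rewrite F_sum_length natr_sum; apply: ler_sum => j _.
    have := card_factorizations_of_length j n0; rewrite -/k.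
    rewrite -(ler_nat R) natrM natrX => hj.
    rewrite mulrA ler_pdivlMr ?ltr0n ?fact_gt0// (le_trans hj)//.
    rewrite -mulrA [X in _ * X]mulrC mulrA ler_pdivlMr ?exprn_gt0// -exprMn.
    rewrite (le_trans (exprn_le_fact _ _))// ?mulr_ge0 ?(ltW r0)//.
    by rewrite expRM_natl Er.
  apply: le_trans st _; rewrite -mulr_sumr ler_wpM2l//.
    by rewrite divr_ge0// exprn_ge0// ltW.
  by apply: sum_expR_ub; rewrite addr_ge0.
apply: le_trans h _.
have kk : k`!%:R <= k%:R ^+ k :> R.
  rewrite -natrX ler_nat; elim: (k) => // i IH; rewrite factS expnS leq_mul//.
  by case: i IH => // i IH; rewrite (leq_trans IH)// leq_exp2r.
have -> : expR 3 * (expR 1 * k%:R / r) ^+ k = k%:R ^+ k / r ^+ k * expR (k%:R + 3).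
  by rewrite !exprMn exprVn -expRM_natr mul1r (expRD k%:R); ring.
by rewrite ler_pM2r ?expR_gt0// ler_pM2r ?invr_gt0 ?exprn_gt0.
Qed.

End RealBounds.

(** * Rankin's bound for the sum of n^(-s) over omega(n) = k *)

Lemma sum_multiples (V : nmodType) (h : nat -> V) (p N : nat) : (0 < p)%N ->
  \sum_(1 <= n < N.+1 | (p %| n)%N) h n =
  \sum_(1 <= m < (N %/ p).+1) h (p * m)%N.
Proof.
move=> p0; elim: N => [|N IH]; first by rewrite div0n !big_geq.
rewrite big_mkcond big_nat_recr//= -big_mkcond /= IH divnS//.
case: ifP => pN; last by rewrite addr0.
rewrite add1n [RHS]big_nat_recr//=; congr (_ + h _).
by have := divnK pN; rewrite divnS// pN mulnC add1n => ->.
Qed.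

Lemma primes_mul_dvd p m : prime p -> (0 < m)%N -> (p %| m)%N ->
  primes (p * m) = primes m.
Proof.
move=> pp m0 pm; apply/eq_primes => q; rewrite (primesM _ (prime_gt0 pp) m0).
rewrite (primes_prime pp) mem_seq1; case: eqP => //= ->.
by rewrite mem_primes pp m0 pm.
Qed.

Lemma perm_primes_mul p m : prime p -> (0 < m)%N -> ~~ (p %| m)%N ->
  perm_eq (primes (p * m)) (p :: primes m).
Proof.
move=> pp m0 pm; apply: uniq_perm; rewrite /= ?primes_uniq ?mem_primes//.
  by rewrite (negPf pm) !andbF.
by move=> q; rewrite (primesM _ (prime_gt0 pp) m0) (primes_prime pp) !inE.
Qed.

Section EulerProduct.
Variables (R : realType) (s t : R).
Hypotheses (s1 : 1 <= s) (t0 : 0 <= t).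

Definition omega_weight n : R := t ^+ size (primes n) * n%:R `^ (- s).

(** Restricting to primes below z allows the Euler product to be built one prime at a time, with
    finite sums throughout. *)
Definition smooth_weight z n : R :=
  if all [pred p | (p < z)%N] (primes n) then omega_weight n else 0.

Lemma smooth_weight_ge0 z n : 0 <= smooth_weight z n.
Proof.
by rewrite /smooth_weight; case: ifP => // _; rewrite mulr_ge0 ?exprn_ge0 ?powR_ge0.
Qed.

Lemma smooth_weightS z n : (0 < n)%N -> ~~ (prime z && (z %| n)%N) ->
  smooth_weight z.+1 n = smooth_weight z n.
Proof.
move=> n0 zn; rewrite /smooth_weight; congr (if _ then _ else _).
apply: eq_in_all => p /=; rewrite mem_primes => /and3P[pp _ pn].
by rewrite ltnS leq_eqVlt; case: eqP => //= pz; rewrite -pz pp pn in zn.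
Qed.

(** Multiplying by z brings in a new prime, hence a factor t, only if z does not divide m
    already. *)
Lemma smooth_weightM z m : prime z -> (0 < m)%N ->
  smooth_weight z.+1 (z * m) =
  z%:R `^ (- s) *
    (if (z %| m)%N then smooth_weight z.+1 m else t * smooth_weight z m).
Proof.
move=> pz m0; rewrite /smooth_weight /omega_weight natrM powRM//.
have [zm|zm] := boolP (z %| m)%N.
  by rewrite primes_mul_dvd//; case: ifP => _; ring.
have pe := perm_primes_mul pz m0 zm.
rewrite (perm_all _ pe) (perm_size pe) /= ltnSn /=.
have -> : all [pred p | (p < z.+1)%N] (primes m) = all [pred p | (p < z)%N] (primes m).
  apply: eq_in_all => p /=; rewrite mem_primes => /and3P[pp _ pm].
  by rewrite ltnS leq_eqVlt; case: eqP => //= e; rewrite -e pm in zm.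
by case: ifP => _; rewrite ?exprS; ring.
Qed.

(** Let T be the sum over multiples of z, S the sum at level z, and w = z^(-s) <= 1/2. Writing n = z
    m gives T <= w (T + t S), so T <= 2 w t S; the factor 2 replaces the geometric series over
    powers of z. *)
Lemma smooth_sumS z N : prime z ->
  \sum_(1 <= n < N.+1) smooth_weight z.+1 n <=
  (1 + 2 * t * z%:R `^ (- s)) * \sum_(1 <= n < N.+1) smooth_weight z n.
Proof.
move=> pz; set S := \sum_(1 <= n < N.+1) smooth_weight z n.
have S0 : 0 <= S by apply: sumr_ge0 => n _; exact: smooth_weight_ge0.
rewrite (bigID (fun n => (z %| n)%N))/=; set T := (X in X + _ <= _).
set U := (X in _ + X <= _).
have US : U <= S.
  rewrite /U /S big_mkcond big_nat_cond [X in _ <= X]big_nat_cond.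
  apply: ler_sum => n /andP[/andP[n0 _] _]; case: ifPn => zn.
    by rewrite smooth_weightS// (negPf zn) andbF.
  exact: smooth_weight_ge0.
have z2 : z%:R `^ (- s) <= 2^-1 :> R.
  rewrite powRN lef_pV2 ?posrE ?powR_gt0 ?ltr0n ?prime_gt0//.
  rewrite (le_trans (_ : 2 <= z%:R))//; first by rewrite ler_nat prime_gt1.
  by apply: le1r_powR; rewrite // ler1n prime_gt0.
set w := z%:R `^ (- s) in z2 *.
have w0 : 0 <= w by exact: powR_ge0.
have TS : T <= w * (T + t * S).
  have -> : T + t * S = \sum_(1 <= m < N.+1)
      ((if (z %| m)%N then smooth_weight z.+1 m else 0) + t * smooth_weight z m).
    by rewrite big_split /= -big_mkcond mulr_sumr.
  rewrite {1}/T sum_multiples ?prime_gt0// mulr_sumr.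
  (* Extending the range of m from N/z to N adds only nonnegative terms. *)
  rewrite [X in _ <= X](@big_cat_nat _ _ _ (N %/ z).+1)//=; last first.
    by rewrite ltnS leq_div.
  rewrite -[X in X <= _]addr0 lerD//.
    rewrite big_nat_cond [X in _ <= X]big_nat_cond.
    apply: ler_sum => m /andP[/andP[m0 _] _]; rewrite smooth_weightM//.
    rewrite ler_wpM2l//; case: ifP => _; last by rewrite add0r.
    by rewrite lerDl mulr_ge0 ?smooth_weight_ge0.
  apply: sumr_ge0 => m _; rewrite mulr_ge0// addr_ge0//.
    by case: ifP => // _; exact: smooth_weight_ge0.
  by rewrite mulr_ge0 ?smooth_weight_ge0.
have T0 : 0 <= T by apply: sumr_ge0 => n _; exact: smooth_weight_ge0.
have : w * T <= 2^-1 * T by rewrite ler_wpM2r.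
have : T <= w * T + w * t * S by move: TS; rewrite mulrDr mulrA.
rewrite mulrDl mul1r; set wtS := w * t * S.
have -> : 2 * t * w * S = 2 * wtS by rewrite /wtS; ring.
lra.
Qed.

Lemma smooth_sum_ub z N :
  \sum_(1 <= n < N.+1) smooth_weight z.+1 n <=
  \prod_(1 <= p < z.+1 | prime p) (1 + 2 * t * p%:R `^ (- s)).
Proof.
elim: z => [|z IH].
  (* No prime is below 1, so only n = 1 has nonzero weight. *)
  rewrite big_geq//; case: N => [|N]; first by rewrite big_geq.
  rewrite big_nat_recl//= big_nat_cond big1 ?addr0.
    by rewrite /smooth_weight /omega_weight /= expr0 powR1 mulr1.
  move=> n /andP[/andP[n0 _] _]; rewrite /smooth_weight.
  case: ifP => // /allP h.
  have := h (pdiv n.+1); rewrite mem_primes pdiv_prime ?ltnS// pdiv_dvd /= => /(_ isT).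
  by rewrite ltnS leqn0 => /eqP e; have := pdiv_gt0 n.+1; rewrite e.
rewrite [X in _ <= X]big_mkcond [X in _ <= X]big_nat_recr//=.
rewrite -[X in _ <= X * _]big_mkcond /=.
case: ifP => pz.
  apply: le_trans (smooth_sumS _ pz) _; rewrite mulrC ler_wpM2r//.
  by rewrite addr_ge0// !mulr_ge0// powR_ge0.
rewrite mulr1 (le_trans _ IH)// big_nat_cond [X in _ <= X]big_nat_cond.
apply: ler_sum => n /andP[/andP[n0 _] _].
by rewrite smooth_weightS// pz.
Qed.

Lemma omega_sum_ub N :
  \sum_(1 <= n < N.+1) omega_weight n <=
  \prod_(1 <= p < N.+1 | prime p) (1 + 2 * t * p%:R `^ (- s)).
Proof.
apply: le_trans (smooth_sum_ub N N).
rewrite big_nat_cond [X in _ <= X]big_nat_cond.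
apply: ler_sum => n /andP[/andP[n0 nN] _]; rewrite /smooth_weight.
case: ifPn => // /negP; case; apply/allP => p; rewrite mem_primes /=.
by move=> /and3P[_ _ /(dvdn_leq n0)/leq_ltn_trans]; apply.
Qed.

(** By [primepi_lnD3_ub] the i-th prime is at least i ln (i+3) / 7, and the factors decrease in
    p. *)
Lemma prod_primes_ub N :
  \prod_(1 <= p < N.+1 | prime p) (1 + 2 * t * p%:R `^ (- s)) <=
  \prod_(1 <= i < (primepi N).+1)
    (1 + 2 * t * (i%:R * lnD3 R i / 7) `^ (- s)).
Proof.
elim: N => [|N IH]; first by rewrite !big_geq.
rewrite big_mkcond big_nat_recr//= -big_mkcond /= primepiS.
case: ifP => pN; last by rewrite mulr1 addn0.
rewrite addn1 [X in _ <= X]big_nat_recr//= ler_pM//.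
- by apply: prodr_ge0 => p _; rewrite addr_ge0// !mulr_ge0// powR_ge0.
- by rewrite addr_ge0// !mulr_ge0// powR_ge0.
have h := @primepi_lnD3_ub R N.+1; rewrite primepiS pN addn1 in h.
rewrite lerD2l ler_wpM2l ?mulr_ge0// !powRN.
have i0 : 0 < (primepi N).+1%:R * lnD3 R (primepi N).+1 / 7.
  by rewrite divr_gt0// mulr_gt0// lnD3_gt0.
rewrite lef_pV2 ?posrE ?powR_gt0//.
apply: ge0_ler_powR; rewrite ?nnegrE// ?(ltW i0)//; first by rewrite (le_trans _ s1).
by rewrite ler_pdivrMr// [X in _ <= X]mulrC.
Qed.

End EulerProduct.

Lemma powR_prod (R : realType) (I : Type) (r : seq I) (P : pred I)
    (a : I -> R) (y : R) : (forall i, P i -> 0 <= a i) ->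
  (\prod_(i <- r | P i) a i) `^ y = \prod_(i <- r | P i) a i `^ y.
Proof.
move=> a0; suff [] : 0 <= \prod_(i <- r | P i) a i /\
  (\prod_(i <- r | P i) a i) `^ y = \prod_(i <- r | P i) a i `^ y by [].
elim/big_rec2 : _ => [|i b c Pi [c0 <-]]; first by rewrite powR1.
by rewrite mulr_ge0 ?a0// powRM ?a0.
Qed.

Section OmegaSums.
Variables (R : realType) (s : R).
Hypothesis s1 : 1 < s.

(** The right side is the integral of x^(-s) over [i-1, i]. The inequality follows from e^y >= 1 + y
    and ln i - ln (i-1) >= 1/i. *)
Lemma powRN_telescope i : (1 < i)%N ->
  i%:R `^ (- s) <= (i.-1%:R `^ (1 - s) - i%:R `^ (1 - s)) / (s - 1) :> R.
Proof.
case: i => [//|i]; rewrite ltnS => i0 /=.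
have i0R : 0 < i%:R :> R by rewrite ltr0n.
have i1R : 0 < i.+1%:R :> R by [].
rewrite ler_pdivlMr ?subr_gt0// lerBrDr.
have -> : i%:R `^ (1 - s) = i.+1%:R `^ (1 - s) * expR ((s - 1) * (ln i.+1%:R - ln i%:R)).
  by rewrite !powR_expR// -expRD; congr expR; ring.
have -> : i.+1%:R `^ (- s) = i.+1%:R `^ (1 - s) * i.+1%:R^-1 :> R.
  by rewrite powRD ?powRr1// ?pnatr_eq0 ?implybT// mulrAC divff ?mul1r// pnatr_eq0.
rewrite -mulrA -[X in _ + X]mulr1 -mulrDr ler_wpM2l ?powR_ge0//.
apply: le_trans (expR_ge1Dx _); rewrite [X in _ <= X]addrC lerD2r mulrC.
rewrite ler_wpM2l ?subr_ge0 ?(ltW s1)//.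
rewrite -ln_div ?posrE//; apply: le_trans (ln_ge1B _); last by rewrite divr_gt0.
rewrite invf_div -[X in X - _](divff (lt0r_neq0 i1R)) -mulrBl -natrB// subSnn.
by rewrite mul1r.
Qed.

Lemma sum_tail_ub k m : (0 < k)%N -> (k <= m)%N ->
  \sum_(k.+1 <= i < m.+1) (k%:R / i%:R) `^ s <= k%:R / (s - 1) :> R.
Proof.
move=> k0 km; have k0R : 0 < k%:R :> R by rewrite ltr0n.
apply: le_trans (_ : \sum_(k.+1 <= i < m.+1) k%:R `^ s *
    ((i.-1%:R `^ (1 - s) - i%:R `^ (1 - s)) / (s - 1)) <= _).
  rewrite big_nat_cond [X in _ <= X]big_nat_cond.
  apply: ler_sum => i /andP[/andP[ki _] _].
  have i1 : (1 < i)%N by rewrite (leq_trans _ ki).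
  rewrite powRM// ler_wpM2l ?powR_ge0//.
  rewrite -[_^-1]powR_inv1// -powRrM mulN1r.
  exact: powRN_telescope.
rewrite -mulr_sumr -mulr_suml.
have -> : \sum_(k.+1 <= i < m.+1) (i.-1%:R `^ (1 - s) - i%:R `^ (1 - s)) =
    k%:R `^ (1 - s) - m%:R `^ (1 - s) :> R.
  elim: m km => [|m IH]; first by rewrite leqn0 gtn_eqF.
  rewrite leq_eqVlt => /predU1P[<-|km]; first by rewrite big_geq// subrr.
  by rewrite big_nat_recr//= IH//; lra.
rewrite mulrA ler_pM2r ?invr_gt0 ?subr_gt0// mulrBr.
rewrite -powRD; last by rewrite (gt_eqF k0R) implybT.
rewrite (_ : s + (1 - s) = 1); last by lra.
rewrite powRr1 ?(ltW k0R)// gerBl.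
by rewrite mulr_ge0 ?powR_ge0.
Qed.

(** With q = k/i >= 1, ln (k+3) <= ln (i+3) + ln q <= ln (i+3) + q, which is at most 3 q ln (i+3)
    because ln (i+3) >= 1/2. Hence the constant 21, three times 7. *)
Lemma lnD3_ratio i k : (0 < i)%N -> (i <= k)%N ->
  7 * (k%:R * lnD3 R k) / (i%:R * lnD3 R i) <= 21 * (k%:R / i%:R) ^+ 2.
Proof.
move=> i0 ik; have k0 := leq_trans i0 ik.
have iR : 0 < i%:R :> R by rewrite ltr0n.
have kR : 0 < k%:R :> R by rewrite ltr0n.
have ikR : i%:R <= k%:R :> R by rewrite ler_nat.
have li := lnD3_ge R i; have li0 := lnD3_gt0 R i.
set q := k%:R / i%:R.
have q1 : 1 <= q by rewrite ler_pdivlMr// mul1r.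
have kq : k%:R = q * i%:R by rewrite mulfVK// gt_eqF.
have lk : lnD3 R k <= lnD3 R i + q.
  have : lnD3 R k <= ln ((i%:R + 3) * q).
    apply: le_ln; first by lra.
    by rewrite mulrDl [i%:R * q]mulrC -kq lerD2l; lra.
  rewrite lnM_gt0//; [|lra] => h; apply: le_trans h _.
  have := @ln_leB1 R q; rewrite lerD2l; move=> /(_ (lt_le_trans ltr01 q1)) h.
  by apply: le_trans h _; rewrite gerBl.
have lk3 : lnD3 R k <= 3 * q * lnD3 R i.
  have : q * (1/2) <= q * lnD3 R i by rewrite ler_wpM2l//; lra.
  have : 1 * lnD3 R i <= q * lnD3 R i by rewrite ler_wpM2r//; lra.
  lra.
rewrite ler_pdivrMr ?mulr_gt0//.
have -> : 21 * q ^+ 2 * (i%:R * lnD3 R i) = 7 * (k%:R * (3 * q * lnD3 R i)).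
  by rewrite kq; ring.
by rewrite ler_pM2l// ler_pM2l.
Qed.

(* Rankin's bound with t = (k ln (k+3))^s: the i-th factor is O((k/i)^(2s)) for
   i <= k, and these multiply to O(1)^k because k^k / k! <= e^k. *)
Lemma prod_index_ub : exists2 D : R, 1 <= D & forall k m, (0 < k)%N ->
  \prod_(1 <= i < m.+1)
    (1 + 2 * (k%:R * lnD3 R k) `^ s * (i%:R * lnD3 R i / 7) `^ (- s)) <= D ^+ k.
Proof.
have hs1 := s1; have s0 : 0 < s by lra.
have p7 : 0 <= (7 : R) `^ s by exact: powR_ge0.
(* The first three terms come from the factors with i <= k, the last from those with i > k. *)
pose D : R := expR (ln 3 + s * ln 21 + 2 * s + 2 * 7 `^ s / (s - 1)).
exists D.
  rewrite -[1]expR0 ler_expR !addr_ge0// ?mulr_ge0// ?ln_ge0 ?invr_ge0; try lra.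
move=> k m k0.
have kR : 0 < k%:R :> R by rewrite ltr0n.
pose f i : R := 1 + 2 * (k%:R * lnD3 R k) `^ s * (i%:R * lnD3 R i / 7) `^ (- s).
rewrite -[X in X <= _]/(\prod_(1 <= i < m.+1) f i).
have fE i : (0 < i)%N ->
    f i = 1 + 2 * (7 * (k%:R * lnD3 R k) / (i%:R * lnD3 R i)) `^ s.
  move=> i0; have iR : 0 < i%:R :> R by rewrite ltr0n.
  have lk := lnD3_gt0 R k; have li := lnD3_gt0 R i.
  rewrite /f -mulrA; congr (1 + 2 * _).
  rewrite powRN -powR_inv1 ?powR_ge0// powRAC -powRM ?powR_ge0//; last first.
    by rewrite mulr_ge0 ?ltW.
  congr (_ `^ _); rewrite powR_inv1; last by rewrite divr_ge0// mulr_ge0 ?ltW.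
  by field; rewrite !gt_eqF.
have f1 i : (0 < i)%N -> 1 <= f i.
  by move=> i0; rewrite fE// lerDl mulr_ge0// powR_ge0.
have head : \prod_(1 <= i < k.+1) f i <= expR (k%:R * (ln 3 + s * ln 21 + 2 * s)).
  apply: le_trans (_ : \prod_(1 <= i < k.+1) (3 * 21 `^ s * (k%:R / i%:R) `^ (2 * s)) <= _).
    rewrite big_nat_cond [X in _ <= X]big_nat_cond.
    apply: ler_prod => i /andP[/andP[i0 ik] _].
    rewrite (le_trans _ (f1 _ i0))//= fE//.
    have iR : 0 < i%:R :> R by rewrite ltr0n.
    have q1 : 1 <= k%:R / i%:R :> R by rewrite ler_pdivlMr// mul1r ler_nat.
    (* Since f i = 1 + 2y with y <= Q, the bound 3Q only needs Q >= 1. *)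
    set Q := (21 `^ s * (k%:R / i%:R) `^ (2 * s)) : R.
    have QE : Q = (21 * (k%:R / i%:R) ^+ 2) `^ s.
      by rewrite powRM ?exprn_ge0 ?divr_ge0// -powR_mulrn ?divr_ge0// -powRrM.
    have Q1 : 1 <= Q.
      have y1 : 1 <= 21 * (k%:R / i%:R) ^+ 2 :> R.
        by have : 1 <= (k%:R / i%:R : R) ^+ 2 by [rewrite exprn_ege1]; lra.
      by rewrite QE (le_trans y1)// le1r_powR// ltW.
    rewrite -[X in _ <= X]mulrA -/Q.
    have : (7 * (k%:R * lnD3 R k) / (i%:R * lnD3 R i)) `^ s <= Q.
      rewrite QE; apply: ge0_ler_powR; rewrite ?nnegrE ?(ltW s0)//.
      - by rewrite ltW// divr_gt0// !mulr_gt0// lnD3_gt0.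
      - by apply: lnD3_ratio.
    lra.
  rewrite big_split /= prodr_const_nat subn1 mulrDr expRD ler_pM ?exprn_ge0 ?mulr_ge0//.
  - by apply: prodr_ge0 => i _; exact: powR_ge0.
  - rewrite exprn_expR; last by rewrite mulr_gt0// powR_gt0.
    by rewrite lnM_gt0 ?powR_gt0// ln_powR.
  (* The product of (k/i)^(2s) over i <= k is (k^k / k!)^(2s) <= e^(2sk). *)
  - rewrite -powR_prod => [|i _]; last by rewrite divr_ge0.
    rewrite prodf_div prodr_const_nat subn1 -natr_prod -fact_prod expRM.
    apply: ge0_ler_powR; rewrite ?nnegrE ?expR_ge0 ?divr_ge0 ?exprn_ge0//.
      by rewrite mulr_ge0// ltW.
    by apply: ler_term_expR.
(* For i > k, ln (k+3) <= ln (i+3) removes the logarithms and leaves f i <= 1 + 2 (7k/i)^s; the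
   excesses over 1 sum to O(k). *)
have tail : \prod_(k.+1 <= i < (maxn k m).+1) f i <= expR (k%:R * (2 * 7 `^ s / (s - 1))).
  apply: le_trans (_ : \prod_(k.+1 <= i < (maxn k m).+1)
      expR (2 * 7 `^ s * (k%:R / i%:R) `^ s) <= _).
    rewrite big_nat_cond [X in _ <= X]big_nat_cond.
    apply: ler_prod => i /andP[/andP[ki _] _].
    have i0 : (0 < i)%N by rewrite (leq_trans _ ki).
    rewrite (le_trans _ (f1 _ i0))//= fE//.
    apply: le_trans (expR_ge1Dx _); rewrite lerD2l -[X in _ <= X]mulrA ler_pM2l//.
    have iR : 0 < i%:R :> R by rewrite ltr0n.
    have lk := lnD3_gt0 R k; have li := lnD3_gt0 R i.
    rewrite -powRM ?divr_ge0//.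
    apply: ge0_ler_powR; rewrite ?nnegrE ?(ltW s0) ?mulr_ge0 ?divr_ge0 ?(ltW li) ?(ltW lk)//.
      by rewrite invr_ge0 mulr_ge0// ltW.
    rewrite -[X in X <= _]mulrA ler_pM2l// ler_pdivrMr ?mulr_gt0//.
    rewrite [X in _ <= X](_ : _ = k%:R * lnD3 R i).
      rewrite ler_pM2l//; apply: le_ln; first by rewrite ltr_wpDl.
      by rewrite lerD2r ler_nat ltnW.
    by field; rewrite gt_eqF.
  rewrite -expR_sum ler_expR -mulr_sumr.
  have -> : k%:R * (2 * 7 `^ s / (s - 1)) = 2 * 7 `^ s * (k%:R / (s - 1)) by ring.
  by rewrite ler_wpM2l ?mulr_ge0// sum_tail_ub// leq_maxl.
have DE : D ^+ k = expR (k%:R * (ln 3 + s * ln 21 + 2 * s)) *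
                   expR (k%:R * (2 * 7 `^ s / (s - 1))).
  by rewrite -expRD -mulrDr expRM_natl.
(* All factors are at least 1, so m may be raised to max(k, m), which makes room for the split at
   k. *)
apply: le_trans (_ : \prod_(1 <= i < (maxn k m).+1) f i <= _).
  rewrite [X in _ <= X](@big_cat_nat _ _ _ m.+1)//= ?ltnS ?leq_maxr//.
  have ge1 a b : (0 < a)%N -> 1 <= \prod_(a <= i < b) f i.
    move=> a0; apply: le_trans (_ : \prod_(a <= i < b) (1 : R) <= _).
      by rewrite prodr_const_nat expr1n.
    rewrite big_nat_cond [X in _ <= X]big_nat_cond.
    apply: ler_prod => i /andP[/andP[ai _] _]; rewrite ler01/= f1//.
    exact: leq_trans ai.
  rewrite ler_peMr ?ge1//.
  by rewrite (le_trans _ (ge1 1%N m.+1 _)).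
rewrite (@big_cat_nat _ _ _ k.+1)//= ?ltnS ?leq_maxl// DE ler_pM//.
- rewrite big_nat_cond; apply: prodr_ge0 => i /andP[/andP[i0 _] _].
  by rewrite (le_trans _ (f1 _ i0)).
- rewrite big_nat_cond; apply: prodr_ge0 => i /andP[/andP[ki _] _].
  by rewrite (le_trans _ (f1 _ _))// (leq_trans _ ki).
Qed.

(** In the weighted sum with t = (k ln (k+3))^s the terms with omega(n) = k carry t^k; dropping the
    others and dividing by t^k gives the bound. *)
Lemma omega_eq_sum_ub : exists2 D : R, 1 <= D & forall k N,
  \sum_(1 <= n < N.+1 | size (primes n) == k) n%:R `^ (- s) <=
  D ^+ k * ((k%:R * lnD3 R k) ^+ k) `^ (- s).
Proof.
have [D D1 hD] := prod_index_ub; exists D => // k N.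
have [->|k0] := posnP k.
  rewrite !expr0 mul1r powR1.
  apply: le_trans (_ : \sum_(1 <= n < N.+1) (if n == 1%N then 1 else 0) <= _).
    rewrite big_mkcond big_nat_cond [X in _ <= X]big_nat_cond.
    apply: ler_sum => n /andP[/andP[n0 _] _].
    rewrite size_eq0 primes_eq0 ltnS leq_eqVlt ltnS leqn0 eqn0Ngt n0 orbF.
    by case: eqP => // ->; rewrite powR1.
  case: N => [|N]; first by rewrite big_geq.
  rewrite big_nat_recl//= big_nat_cond big1 ?addr0//.
  by move=> i /andP[/andP[i0 _] _]; rewrite eqSS gtn_eqF.
have c0 : 0 < k%:R * lnD3 R k by rewrite mulr_gt0 ?ltr0n// lnD3_gt0.
set c := k%:R * lnD3 R k in c0 *.
have t0 : 0 <= c `^ s by exact: powR_ge0.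
have := omega_sum_ub (ltW s1) t0 N.
move=> /le_trans /(_ (prod_primes_ub (ltW s1) t0 N)).
move=> /le_trans /(_ (hD k _ k0)) h.
have -> : (c ^+ k) `^ (- s) = ((c `^ s) ^+ k)^-1.
  by rewrite powRN -(powR_mulrn k (ltW c0)) -(powR_mulrn k (powR_ge0 c s)) powRAC.
rewrite ler_pdivlMr ?exprn_gt0 ?powR_gt0//; apply: le_trans h.
rewrite mulr_suml big_mkcond; apply: ler_sum => n _; rewrite /omega_weight.
case: eqP => [->|_]; first by rewrite mulrC.
by rewrite mulr_ge0 ?exprn_ge0 ?powR_ge0.
Qed.

End OmegaSums.

(** * Asymptotics *)

Section Asymptotics.
Variable R : realType.
Implicit Types (b s C eta e v : R).

(* For k = 0 the junk value ln 0 = 0 is the right one in both bounds. *)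
Lemma slice_ub b s : 1 < s -> 1 < b -> exists2 C : R, 0 <= C & forall k N,
  \sum_(1 <= n < N.+1 | size (primes n) == k) (F n)%:R `^ b <=
    expR (3 * b + C * k%:R + s * ln N%:R +
          k%:R * ((b - s) * ln k%:R - (b + s) * ln (lnD3 R k)))
  /\ forall n, (0 < n <= N)%N -> size (primes n) = k ->
    k%:R * (ln k%:R + ln (lnD3 R k)) <= ln N%:R + C * k%:R.
Proof.
move=> s1 b1; have [D D1 hD] := omega_eq_sum_ub s1.
have lD : 0 <= ln D by exact: ln_ge0.
have D0 : 0 < D by lra.
(* The b comes from the factor e^k in [F_ub], raised to the power b, and ln D from
   [omega_eq_sum_ub]. *)
exists (b + ln D) => [|k N]; first lra.
have l3 := lnD3_gt0 R k.
have Ak : ((k%:R * lnD3 R k) ^+ k) `^ (- s) =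
    expR (- s * (k%:R * (ln k%:R + ln (lnD3 R k)))).
  have [->|k0] := posnP k; first by rewrite expr0 powR1 mul0r mulr0 expR0.
  have c0 : 0 < k%:R * lnD3 R k by rewrite mulr_gt0 ?ltr0n.
  by rewrite powR_expR ?exprn_gt0// lnXn// lnM_gt0 ?ltr0n// [in RHS]mulr_natl.
have DA : D ^+ k * ((k%:R * lnD3 R k) ^+ k) `^ (- s) =
    expR (k%:R * ln D - s * (k%:R * (ln k%:R + ln (lnD3 R k)))).
  by rewrite Ak exprn_expR// -expRD mulNr.
(* A single n in the slice bounds the sum from below by n^(-s); comparing logarithms then limits
   k. *)
split; last first.
  move=> n /andP[n0 nN] nk; have := hD k N; rewrite DA => h.
  have : n%:R `^ (- s) <= expR (k%:R * ln D - s * (k%:R * (ln k%:R + ln (lnD3 R k)))).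
    have nN1 : n \in index_iota 1 N.+1 by rewrite mem_index_iota n0 ltnS.
    apply: le_trans h; rewrite big_mkcond (bigD1_seq n nN1) ?iota_uniq//=.
    rewrite nk eqxx lerDl; apply: sumr_ge0 => i _.
    by case: ifP => // _; exact: powR_ge0.
  rewrite powR_expR ?ltr0n// ler_expR.
  set T := k%:R * (_ + _) => h1.
  have lnN : ln n%:R <= ln N%:R :> R by apply: le_ln; rewrite ?ltr0n ?ler_nat.
  have h2 : T <= ln n%:R + k%:R * ln D / s.
    rewrite -(ler_pM2l (lt_trans ltr01 s1)) mulrDr [s * (_ / s)]mulrC divfK; lra.
  have h3 : k%:R * ln D / s <= k%:R * ln D.
    by rewrite ler_pdivrMr; [rewrite ler_peMr ?mulr_ge0// ltW|lra].
  have : 0 <= b * k%:R by rewrite mulr_ge0//; lra.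
  rewrite mulrDl [ln D * _]mulrC; lra.
case: N => [|N]; first by rewrite big_geq// expR_ge0.
have N0 : 0 < N.+1%:R :> R by [].
set B := (expR 3 * (expR 1 * k%:R / lnD3 R k) ^+ k) `^ b.
(* [F_ub] bounds F(n)^b by [B], and the factor ([N.+1] / n)^s >= 1 brings in the sum of n^(-s). *)
apply: le_trans (_ : \sum_(1 <= n < N.+2 | size (primes n) == k)
    B * N.+1%:R `^ s * n%:R `^ (- s) <= _).
  rewrite big_nat_cond [X in _ <= X]big_nat_cond.
  apply: ler_sum => n /andP[/andP[n0 nN] /eqP nk].
  have nR : 0 < n%:R :> R by rewrite ltr0n.
  rewrite -[X in X <= _]mulr1 -mulrA ler_pM ?powR_ge0//.
    apply: ge0_ler_powR; rewrite ?nnegrE//; first lra.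
      by rewrite mulr_ge0 ?expR_ge0// exprn_ge0// divr_ge0 ?mulr_ge0 ?expR_ge0// ltW.
    by have := F_ub R n0; rewrite nk.
  rewrite powRN ler_pdivlMr ?powR_gt0// mul1r.
  by apply: ge0_ler_powR; rewrite ?nnegrE// ?ler_nat//; lra.
rewrite -mulr_sumr; apply: le_trans (ler_wpM2l _ (hD k N.+1)) _.
  by rewrite mulr_ge0 ?powR_ge0.
rewrite DA (powR_expR _ N0).
have BE : B = expR (b * (3 + k%:R * (1 + ln k%:R - ln (lnD3 R k)))).
  rewrite /B; have [->|k0] := posnP k.
    by rewrite expr0 mulr1 mul0r addr0 powR_expR ?expR_gt0// expRK.
  have kR : 0 < k%:R :> R by rewrite ltr0n.
  have c0 : 0 < expR 1 * k%:R / lnD3 R k by rewrite divr_gt0// mulr_gt0// expR_gt0.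
  rewrite powR_expR; last by rewrite mulr_gt0 ?expR_gt0// exprn_gt0.
  rewrite lnM_gt0 ?expR_gt0 ?exprn_gt0// expRK lnXn// ln_div ?posrE ?mulr_gt0 ?expR_gt0//.
  by rewrite lnM_gt0 ?expR_gt0// expRK [in RHS]mulr_natl.
rewrite BE -!expRD ler_expR le_eqVlt; apply/orP; left; apply/eqP; ring.
Qed.

Lemma ln2_le1 : ln 2 <= 1 :> R.
Proof. by have := @ln_leB1 R 2; lra. Qed.

(* x = exp (exp (exp v)), so v = log_3 x, l2 = log_2 x, l1 = log x, and
   log (L x) = w v. *)
Lemma scale_facts v : 10 <= v -> let l2 := expR v in let l1 := expR l2 in
  let w := l1 / l2 in
  [/\ v ^+ 2 <= 2 * l2, 5 * v <= l2, w = expR (l2 - v), 2 * l2 <= w & l1 = w * l2].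
Proof.
move=> v10 l2 l1 w.
have h1 : v ^+ 2 <= 2 * l2 by apply: (@exprn_le_fact R v 2); lra.
have h2 : 5 * v <= l2 by have : v * 10 <= v * v by [rewrite ler_pM2l; lra]; lra.
have wE : w = expR (l2 - v) by rewrite expRB.
split => //.
  rewrite wE (_ : l2 - v = v + (l2 - 2 * v)); last ring.
  rewrite expRD -/l2 mulrC ler_wpM2l ?expR_ge0//.
  by apply: le_trans (expR_ge1Dx _); lra.
by rewrite divfK// gt_eqF ?expR_gt0.
Qed.

(** The cases split at k = (1 - eta) w. Above, ln (ln (k+3)) is at least v - 1 and supplies the
    saving 2 b k v. Below, the left side of the hypothesis falls short of l1 by about eta l1, and (b
    - s) eta l1 far exceeds w v. *)
Lemma slice_exponent b s C eta : 1 < s -> s < b -> 0 <= C -> 0 < eta <= 1 / 2 ->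
  exists M, forall v, M <= v -> forall k, let l2 := expR v in let l1 := expR l2 in
    let w := l1 / l2 in
    k%:R * (ln k%:R + ln (lnD3 R k)) <= l1 + C * k%:R ->
    3 * b + C * k%:R + s * l1 +
      k%:R * ((b - s) * ln k%:R - (b + s) * ln (lnD3 R k)) <=
    b * l1 - 2 * b * (1 - eta) * (w * v) + (C * (1 + b) + 5 * b) * w.
Proof.
move=> s1 sb C0 /andP[eta0 eta1].
pose d := b - s; have d0 : 0 < d by rewrite /d; lra.
(* From [M1] on, 2 b v outweighs the other coefficients of k; from [M2] on, d eta l2 outweighs (d +
   2b) v, by v^2 <= 2 l2. *)
pose M1 := (C * (1 + b) + 2 * b) / (2 * b).
pose M2 := 2 * (d + 2 * b) / (d * eta).
exists (Num.max 10 (Num.max M1 M2)) => v; rewrite !ge_max => /and3P[v10 vM1 vM2] k l2 l1 w.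
have [vl2 vl2' wE lw l1E] := scale_facts v10; rewrite -/l2 in vl2 vl2' wE lw l1E.
rewrite -/l1 -/w in wE lw l1E.
have b0 : 0 < b by lra.
have h1 : C * (1 + b) + 2 * b <= 2 * b * v.
  by move: vM1; rewrite ler_pdivrMr ?mulr_gt0// [v * _]mulrC.
have h2 : (d + 2 * b) * v <= d * eta * l2.
  move: vM2; rewrite ler_pdivrMr ?mulr_gt0// => h.
  have : 2 * (d + 2 * b) * v <= v * (d * eta) * v by rewrite ler_wpM2r//; lra.
  have : d * eta * v ^+ 2 <= d * eta * (2 * l2) by rewrite ler_wpM2l// mulr_ge0 ?ltW.
  have -> : v * (d * eta) * v = d * eta * v ^+ 2 by ring.
  lra.
have w0 : 0 < w by lra.
set a := ln k%:R; set c := ln (lnD3 R k) => hk.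
(* The exponent is regrouped into b l1, the saving -2 b k c, and d times the quantity k (a + c) -
   l1, which [hk] bounds by C k. *)
have -> : 3 * b + C * k%:R + s * l1 + k%:R * ((b - s) * a - (b + s) * c) =
  b * l1 + (3 * b + C * k%:R - 2 * b * (k%:R * c) + d * (k%:R * (a + c) - l1)).
  by rewrite /d; ring.
rewrite -[X in _ <= X]addrA lerD2l.
have l20 : 0 < l2 by exact: expR_gt0.
have w1 : 1 <= w by lra.
have bw : 3 * b * 1 <= 3 * b * w by rewrite ler_wpM2l//; lra.
have [kw|kw] := leP ((1 - eta) * w) k%:R.
  have kw2 : w / 2 <= k%:R.
    by apply: le_trans kw; rewrite mulrC ler_wpM2r ?(ltW w0)//; lra.
  have k0 : 0 < k%:R :> R by lra.
  have lna : l2 / 2 <= lnD3 R k.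
    apply: le_trans (_ : ln (w / 2) <= _); last by apply: le_ln; lra.
    rewrite ln_div ?posrE// wE expRK; have := ln2_le1; lra.
  have cv : v - 1 <= c.
    apply: le_trans (_ : ln (l2 / 2) <= _); last by apply: le_ln; lra.
    rewrite ln_div ?posrE// /l2 expRK; have := ln2_le1; lra.
  have hd : d * (k%:R * (a + c) - l1) <= b * (C * k%:R).
    apply: le_trans (_ : d * (C * k%:R) <= _); first by rewrite ler_pM2l//; lra.
    by rewrite ler_wpM2r ?mulr_ge0 ?(ltW k0)// /d; lra.
  have hc : 2 * b * (k%:R * (v - 1)) <= 2 * b * (k%:R * c).
    by rewrite ler_pM2l ?mulr_gt0// ler_pM2l.
  have hkw : (2 * b * v - C * (1 + b) - 2 * b) * ((1 - eta) * w) <=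
      (2 * b * v - C * (1 + b) - 2 * b) * k%:R by rewrite ler_wpM2l//; lra.
  have hew : (C * (1 + b) + 2 * b) * ((1 - eta) * w) <= (C * (1 + b) + 2 * b) * (1 * w).
    rewrite ler_wpM2l ?addr_ge0 ?mulr_ge0//; try lra.
    by rewrite ler_wpM2r ?(ltW w0)//; lra.
  clear -hd hc hkw hew bw. lra.
have kw1 : k%:R <= w.
  by apply: le_trans (ltW kw) _; rewrite ler_piMl ?(ltW w0)//; lra.
have al2 : a <= l2.
  have [k0|k0] := posnP k; first by rewrite /a k0 ln0// ltW.
  rewrite -[l2]expRK; apply: le_ln; first by rewrite ltr0n.
  rewrite -/l1 l1E (le_trans kw1)// ler_peMr ?(ltW w0)//; lra.
have l1k : k%:R + 3 <= l1.
  have : w * 4 <= w * l2 by rewrite ler_pM2l//; lra.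
  rewrite l1E; lra.
have cv : c <= v.
  rewrite -[v]expRK; apply: le_ln; first exact: lnD3_gt0.
  rewrite -/l2 -[l2]expRK -/l1; apply: le_ln => //.
have c1 : - 1 <= c.
  apply: le_trans (ln_ge1B (lnD3_gt0 R k)).
  have : (lnD3 R k)^-1 <= 2.
    by have := lnD3_ge R k; rewrite invf_ple ?posrE ?lnD3_gt0//; lra.
  lra.
have k0 : 0 <= k%:R :> R by [].
have hkac : k%:R * (a + c) <= (1 - eta) * w * (l2 + v).
  apply: le_trans (_ : k%:R * (l2 + v) <= _); first by rewrite ler_wpM2l//; lra.
  by rewrite ler_wpM2r ?(ltW kw)//; lra.
have hd : d * (k%:R * (a + c)) <= d * ((1 - eta) * w * (l2 + v)) by rewrite ler_pM2l.
have hc : 2 * b * (k%:R * - 1) <= 2 * b * (k%:R * c).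
  by rewrite ler_pM2l ?mulr_gt0// ler_wpM2l.
have hC : (C + 2 * b) * k%:R <= (C + 2 * b) * w.
  by rewrite ler_wpM2l// addr_ge0// mulr_ge0// ltW.
have hw : (d + 2 * b) * v * w <= d * eta * l2 * w by rewrite ler_wpM2r// ltW.
have [d0' eta0' w0' b0'] : [/\ 0 <= d, 0 <= eta, 0 <= w & 0 <= b] by split; apply/ltW.
have hew : 0 <= d * eta * (w * v) + 2 * b * eta * (w * v).
  have v0 : 0 <= v by lra.
  by apply: addr_ge0; do !apply: mulr_ge0 => //.
have hCb : 0 <= C * b * w by do !apply: mulr_ge0 => //.
rewrite [d * (_ - l1)]mulrBr l1E; clear -bw hd hc hC hw hew hCb; lra.
Qed.

End Asymptotics.

(** * Upper and lower bounds for the sum, at x = exp (exp (exp v)) *)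

Section MainBounds.
Variable R : realType.
Implicit Types (b e v : R).

Lemma exp2_omega_leq n : (0 < n)%N -> (2 ^ size (primes n) <= n)%N.
Proof.
move=> n0; rewrite [X in (_ <= X)%N](prod_prime_decomp n0) prime_decompE big_map /=.
rewrite -sum1_size expn_sum big_seq [X in (_ <= X)%N]big_seq; apply: leq_prod => p pn.
have l0 : (0 < logn p n)%N by rewrite logn_gt0.
have pp : prime p by move: pn; rewrite mem_primes => /and3P[].
by rewrite (leq_trans (prime_gt1 pp))// -[X in (X <= _)%N]expn1 leq_exp2l ?prime_gt1.
Qed.

Lemma sum_by_omega (f : nat -> R) N K : (forall n, 0 <= f n) ->
  (forall n, (0 < n <= N)%N -> (size (primes n) < K)%N) ->
  \sum_(1 <= n < N.+1) f n <=
  \sum_(k < K) \sum_(1 <= n < N.+1 | size (primes n) == k) f n.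
Proof.
move=> f0 hK; rewrite (exchange_big_dep xpredT)//=.
rewrite big_nat_cond [X in _ <= X]big_nat_cond.
apply: ler_sum => n /andP[nN _]; rewrite (bigD1 (Ordinal (hK n nN)))//=.
by rewrite lerDl sumr_ge0.
Qed.

(** Each of the O(log x) slices by omega(n) obeys [slice_exponent], and their number is absorbed
    into e^w. Half of e pays for eta, the other half for the terms O(w), which are small against w
    v. *)
Lemma sum_F_ub b e : 1 < b -> 0 < e -> exists M, forall v, M <= v ->

  \sum_(1 <= n < (Num.truncn (expR (expR (expR v)))).+1) (F n)%:R `^ b <=
    expR (b * expR (expR v) - (2 * b - e) * (expR (expR v) / expR v * v)).
Proof.
move=> b1 e0; pose s := (1 + b) / 2.
have s1 : 1 < s by rewrite /s; lra.
have sb : s < b by rewrite /s; lra.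
have [C C0 hC] := slice_ub s1 b1.
pose eta := Num.min (1 / 2) (e / (4 * b)).
have eta0 : 0 < eta <= 1 / 2.
  by rewrite /eta ge_min lexx lt_min divr_gt0//= ?divr_gt0// mulr_gt0//; lra.
have etab : 2 * b * eta <= e / 2.
  apply: le_trans (_ : 2 * b * (e / (4 * b)) <= _).
    by rewrite ler_pM2l ?mulr_gt0//; [rewrite /eta ge_min lexx orbT|lra].
  by rewrite le_eqVlt; apply/orP; left; apply/eqP; field; rewrite gt_eqF; lra.
have [M hM] := slice_exponent s1 sb C0 eta0.
pose D := C * (1 + b) + 5 * b.
exists (Num.max M (Num.max 10 (2 * (D + 1) / e))) => v.
rewrite !ge_max => /and3P[vM v10 vD].
set l2 := expR v; set l1 := expR l2; set w := l1 / l2.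
have [vl2 vl2' wE lw l1E] := scale_facts v10; rewrite -/l2 in vl2 vl2' wE lw l1E.
rewrite -/l1 -/w in wE lw l1E.
set N := Num.truncn _.
have lnN : ln N%:R <= l1.
  have [->|N0] := posnP N; first by rewrite ln0// expR_ge0.
  rewrite -[l1]expRK; apply: le_ln; first by rewrite ltr0n.
  by rewrite truncn_le// expR_ge0.
(* From 2^omega(n) <= n and ln 2 >= 1/2 it follows that omega(n) <= 2 l1. *)
pose K := (Num.truncn (2 * l1)).+1.
pose B := expR (b * l1 - 2 * b * (1 - eta) * (w * v) + D * w).
have l10 : 0 < l1 by exact: expR_gt0.
apply: le_trans (sum_by_omega (K := K) _ _) _.
- by move=> n; exact: powR_ge0.
- move=> n /andP[n0 nN]; rewrite ltnS truncn_ge_nat; last by rewrite mulr_ge0 ?(ltW l10).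
  have := exp2_omega_leq n0; rewrite -(ler_nat R) natrX => h.
  have h2 : (size (primes n))%:R * ln 2 <= l1.
    apply: le_trans lnN; rewrite mulr_natl -lnXn//.
    apply: le_ln; rewrite ?exprn_gt0//.
    by apply: le_trans h _; rewrite ler_nat.
  have l2h : 1 / 2 <= ln 2 :> R by have := @ln_ge1B R 2; lra.
  have : (size (primes n))%:R * (1 / 2) <= (size (primes n))%:R * ln 2 :> R.
    by rewrite ler_wpM2l.
  lra.
apply: le_trans (_ : \sum_(k < K) B <= _).
  apply: ler_sum => k _.
  (* The exponent bound needs some n in the slice to limit k; an empty slice sums to 0. *)
  have [[n nN nk]|nex] := pselect (exists2 n, (0 < n <= N)%N & size (primes n) = k).
    have [h1 h2] := hC k N; apply: le_trans h1 _; rewrite ler_expR.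
    have := h2 n nN nk => h3.
    apply: le_trans (hM v vM k _); rewrite -/l2 -/l1.
      by rewrite !lerD2r lerD2l ler_pM2l//; lra.
    by apply: le_trans h3 _; rewrite lerD2r.
  rewrite big_nat_cond big1 ?expR_ge0// => n /andP[nN /eqP nk].
  by case: nex; exists n.
rewrite sumr_const card_ord -[B *+ K]mulr_natl.
(* K <= 2 l1 + 1 <= e^2 l1 = e^(2 + l2), and 2 + l2 <= 2 l2 <= w. *)
have KE : K%:R <= expR w.
  apply: le_trans (_ : expR (2 + l2) <= _); last by rewrite ler_expR; lra.
  have t0 : 0 <= 2 * l1 by lra.
  have := truncn_le (2 * l1); rewrite t0 => hK.
  have e2 : 3 <= expR 2 :> R by have := @expR_ge1Dx R 2; lra.
  have : 3 * l1 <= expR 2 * l1 by rewrite ler_wpM2r ?(ltW l10).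
  have := @expR_ge1Dx R l2; rewrite -/l1.
  rewrite (expRD 2) -/l1 /K -addn1 natrD; lra.
apply: le_trans (ler_wpM2r (expR_ge0 _) KE) _.
rewrite -expRD ler_expR.
have w0 : 0 < w by lra.
have h1 : (D + 1) * w <= e / 2 * v * w.
  rewrite ler_wpM2r ?(ltW w0)//; move: vD; rewrite ler_pdivrMr//; lra.
have h2 : 2 * b * eta * (w * v) <= e / 2 * (w * v).
  by rewrite ler_wpM2r// mulr_ge0 ?(ltW w0)//; lra.
clear -h1 h2; lra.
Qed.

(** The witness is the product of the first k primes; the first j of them serve as leaders in
    [F_prod_primes_lb], so F(n) >= j^(k-j). *)
Lemma F_large v : 10 <= v ->
  let l2 := expR v in let l1 := expR l2 in let w := l1 / l2 in
  exists2 n, (0 < n <= Num.truncn (expR l1))%N &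
    expR (l1 - 2 * (w * v) - 6 * w) <= (F n)%:R.
Proof.
move=> v10 l2 l1 w.
have [vl2 vl2' wE lw l1E] := scale_facts v10; rewrite -/l2 in vl2 vl2' wE lw l1E.
rewrite -/l1 -/w in wE lw l1E.
have l20 : 0 < l2 by exact: expR_gt0.
have l10 : 0 < l1 by exact: expR_gt0.
have w0 : 0 < w by lra.
have l1l2 : 1 + l2 <= l1 by exact: expR_ge1Dx.
(* With the constant 4, Chebyshev gives pi(2N) >= l1 / ln (2N), while ln (2N) <= ln (8 l1) <= l2 +
   3. *)
pose N := Num.truncn (4 * l1).
have [N4 N4'] : N%:R <= 4 * l1 /\ 4 * l1 < N%:R + 1.
  have t0 : 0 <= 4 * l1 by lra.
  by rewrite natr1; have /andP[] := truncn_itv t0.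
have N0 : (0 < N)%N by rewrite -(ltr_nat R); lra.
pose Y := N.*2.
have Y0 : 0 < Y%:R :> R by rewrite ltr0n double_gt0.
have YN : Y%:R = 2 * N%:R :> R by rewrite /Y -muln2 natrM mulrC.
have lnY : ln Y%:R <= l2 + 3.
  apply: le_trans (_ : ln (2 ^+ 3 * l1) <= _).
    by apply: le_ln => //; rewrite YN; lra.
  rewrite lnM_gt0// lnXn// /l1 expRK; have := ln2_le1 R; lra.
have l23 : 0 < l2 + 3 by lra.
have piY : l1 / (l2 + 3) <= (primepi Y)%:R.
  rewrite ler_pdivrMr//; apply: le_trans (_ : (primepi Y)%:R * ln Y%:R <= _).
    by apply: le_trans (primepi_lb R N0); lra.
  by rewrite ler_wpM2l.
(* This k ensures that k primes up to Y have product at most Y^k <= e^(k (l2 + 3)) <= e^l1. *)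
pose k := Num.truncn (l1 / (l2 + 3)); pose j := Num.truncn (w / l2).
have [k1 k2] : k%:R <= l1 / (l2 + 3) /\ l1 / (l2 + 3) < k%:R + 1.
  have t0 : 0 <= l1 / (l2 + 3) by rewrite divr_ge0 ?ltW.
  by rewrite natr1; have /andP[] := truncn_itv t0.
have wl2 : 2 <= w / l2 by rewrite ler_pdivlMr.
have [j1 j2] : j%:R <= w / l2 /\ w / l2 < j%:R + 1.
  have t0 : 0 <= w / l2 by lra.
  by rewrite natr1; have /andP[] := truncn_itv t0.
have kpi : (k <= primepi Y)%N by rewrite -(ler_nat R); lra.
(* Replacing l2 + 3 by l2 costs 3 w/l2, subtracting j costs w/l2, and rounding costs at most 1 <=
   w/l2. *)
have kj : w - 5 * (w / l2) <= k%:R - j%:R.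
  have h1 : w - 3 * (w / l2) <= l1 / (l2 + 3).
    rewrite ler_pdivlMr// l1E.
    have -> : (w - 3 * (w / l2)) * (l2 + 3) = w * l2 - 9 * (w / l2).
      by field; rewrite gt_eqF.
    lra.
  lra.
have w5 : 5 * (w / l2) <= w.
  rewrite mulrA ler_pdivrMr// mulrC ler_pM2l//; lra.
have jk : (j <= k)%N by rewrite -(ler_nat R); lra.
pose m := (k - j)%N.
have mE : m%:R = k%:R - j%:R :> R by rewrite natrB.
pose q := [seq p <- iota 1 Y | prime p].
have sq : size q = primepi Y by rewrite size_filter.
have uq : uniq q by rewrite filter_uniq ?iota_uniq.
have hq i : (i < k)%N -> prime (nth 0%N q i) /\ (nth 0%N q i <= Y)%N.
  move=> ik; have : nth 0%N q i \in q by rewrite mem_nth// sq (leq_trans ik).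
  by rewrite mem_filter mem_iota add1n ltnS => /and3P[].
have nq i i' : (i < k)%N -> (i' < k)%N -> nth 0%N q i = nth 0%N q i' -> i = i'.
  move=> ik ik' /eqP; rewrite nth_uniq ?sq ?(leq_trans ik) ?(leq_trans ik')//.
  by move/eqP.
pose u (i : 'I_j) := nth 0%N q i; pose z (l : 'I_m) := nth 0%N q (j + l).
have iu (i : 'I_j) : (i < k)%N by exact: leq_trans jk.
have iz (l : 'I_m) : (j + l < k)%N by rewrite -(subnKC jk) ltn_add2l.
have hF : (j ^ m <= F ((\prod_i u i) * \prod_l z l))%N.
  apply: F_prod_primes_lb => [i|l|i i'|l l'|i l].
  - by case: (hq _ (iu i)).
  - by case: (hq _ (iz l)).
  - by move=> /(nq _ _ (iu i) (iu i')) /val_inj.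
  - by move=> /(nq _ _ (iz l) (iz l')) /addnI /val_inj.
  - apply/eqP => /(nq _ _ (iu i) (iz l)) e.
    by have := ltn_ord i; rewrite e ltnNge leq_addr.
exists ((\prod_i u i) * \prod_l z l)%N.
  rewrite muln_gt0 !prodn_gt0/= => [|l|i]; last 2 first.
  - by rewrite prime_gt0//; case: (hq _ (iz l)).
  - by rewrite prime_gt0//; case: (hq _ (iu i)).
  rewrite truncn_ge_nat ?expR_ge0//.
  apply: le_trans (_ : (Y ^ k)%:R <= _).
    rewrite ler_nat -(subnKC jk) expnD leq_mul//.
      rewrite -[X in (_ <= _ ^ X)%N]card_ord -prod_nat_const.
      by apply: leq_prod => i _; case: (hq _ (iu i)).
    rewrite -[X in (_ <= _ ^ X)%N]card_ord -prod_nat_const.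
    by apply: leq_prod => l _; case: (hq _ (iz l)).
  rewrite natrX exprn_expR// ler_expR.
  apply: le_trans (_ : k%:R * (l2 + 3) <= _); first by rewrite ler_wpM2l.
  by rewrite -ler_pdivlMr.
apply: le_trans (_ : (j ^ m)%:R <= _); last by rewrite ler_nat.
have j0 : 0 < j%:R :> R by lra.
rewrite natrX exprn_expR// ler_expR.
(* The exponent 2 of L arises here: one v is lost in w = l1 / l2, the other in w / l2. The 1 covers
   the rounding of j, which loses at most half. *)
have lnj : l2 - 2 * v - 1 <= ln j%:R.
  apply: le_trans (_ : ln (w / l2 / 2) <= _); last by apply: le_ln; lra.
  rewrite ln_div ?posrE ?divr_gt0// ln_div ?posrE// wE expRK /l2 expRK.
  have := ln2_le1 R; lra.
apply: le_trans (_ : (w - 5 * (w / l2)) * (l2 - 2 * v - 1) <= _).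
  have -> : (w - 5 * (w / l2)) * (l2 - 2 * v - 1) =
      w * l2 - 2 * (w * v) - 6 * w + 5 * (w / l2) * (2 * v + 1).
    by field; rewrite gt_eqF.
  rewrite -l1E lerDl mulr_ge0//; lra.
by rewrite ler_pM//; [lra|lra|rewrite mE].
Qed.

(** Every large x has the form exp (exp (exp v)) with v = log_3 x large, so eventual statements can
    be proved in terms of v. *)
Lemma near_expR3 (M : R) (P : R -> Prop) :
  (forall v, M <= v -> P (expR (expR (expR v)))) -> \forall x \near +oo%R, P x.
Proof.
move=> hP; near=> x.
have hx : expR (expR (expR M)) <= x by near: x; apply: nbhs_pinfty_ge; rewrite num_real.
have x0 : 0 < x by apply: lt_le_trans hx; exact: expR_gt0.
have h1 : expR (expR M) <= ln x by rewrite -ler_expR lnK.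
have x1 : 0 < ln x by apply: lt_le_trans h1; exact: expR_gt0.
have h2 : expR M <= ln (ln x) by rewrite -ler_expR lnK.
have x2 : 0 < ln (ln x) by apply: lt_le_trans h2; exact: expR_gt0.
have h3 : M <= ln (ln (ln x)) by rewrite -ler_expR lnK.
by have := hP _ h3; rewrite !lnK.
Unshelve. all: by end_near.
Qed.

Lemma L_expR3 v : let l2 := expR v in let l1 := expR l2 in
  L (expR l1) = expR (l1 / l2 * v).
Proof. by move=> l2 l1; rewrite /L /logk /= !expRK mulrAC. Qed.

(** The single term at the n of [F_large] is already this large. *)
Lemma sum_F_lb b v : 0 < b -> 10 <= v ->

  expR (b * (expR (expR v) - 2 * (expR (expR v) / expR v * v) -
             6 * (expR (expR v) / expR v))) <=
  \sum_(1 <= n < (Num.truncn (expR (expR (expR v)))).+1) (F n)%:R `^ b.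
Proof.
move=> b0 v10; have [n nN hn] := F_large v10.
have nN1 : n \in index_iota 1 (Num.truncn (expR (expR (expR v)))).+1.
  by rewrite mem_index_iota ltnS.
rewrite (bigD1_seq n nN1) ?iota_uniq//= -[X in X <= _]addr0 lerD//; last first.
  by apply: sumr_ge0 => i _; exact: powR_ge0.
rewrite mulrC expRM.
by apply: ge0_ler_powR; rewrite ?nnegrE ?expR_ge0 ?(ltW b0).
Qed.

End MainBounds.

(** * The asymptotic formula *)

Local Open Scope classical_set_scope.
Local Open Scope ring_scope.

Theorem theorem1p5 (R : realType) (beta : R) (hbeta : 1 < beta) :
  exists eps : R -> R,
    eps x @[x --> +oo] --> (0 : R) /\
    \forall x \near +oo,
      \sum_(1 <= n < (Num.truncn x).+1) (F n)%:R `^ beta =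
        x `^ beta / L x `^ (2 * beta + eps x).
Proof.
pose S (x : R) := \sum_(1 <= n < (Num.truncn x).+1) (F n)%:R `^ beta.
have b0 : 0 < beta by lra.
(* This is the required identity solved for eps, so the identity holds once S x > 0 and ln (L x) is
   nonzero; the estimates serve to show that eps tends to 0. *)
exists (fun x => (beta * ln x - ln (S x)) / ln (L x) - 2 * beta); split.
  apply/cvgrPdist_le => e e0.
  have [M hM] := sum_F_ub hbeta e0.
  (* For v >= 6 beta / e the error 6 beta w of [sum_F_lb] is at most e w v = e ln (L x). *)
  apply: (@near_expR3 R (Num.max M (Num.max 10 (6 * beta / e)))) => v.
  rewrite !ge_max => /and3P[vM v10 ve]; rewrite L_expR3 !expRK sub0r normrN.
  have := hM v vM; have := sum_F_lb b0 v10.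
  rewrite /= -/(S _); set l2 := expR v; set l1 := expR l2; set w := l1 / l2 => hl hu.
  have w0 : 0 < w by rewrite divr_gt0 ?expR_gt0.
  have wv : 0 < w * v by rewrite mulr_gt0//; lra.
  have S0 : 0 < S (expR l1) by apply: lt_le_trans hl; exact: expR_gt0.
  rewrite -[S _]lnK ?posrE// !ler_expR in hl hu.
  have h6 : 6 * beta * w <= e * v * w.
    by rewrite ler_wpM2r ?(ltW w0)//; move: ve; rewrite ler_pdivrMr// [v * e]mulrC.
  rewrite ler_norml lerBrDr lerBlDr ler_pdivlMr// ler_pdivrMr//.
  by clear -hl hu h6; apply/andP; split; lra.
apply: (@near_expR3 R 10) => v v10; rewrite -/(S _).
have hl := sum_F_lb b0 v10; rewrite /= -/(S _) in hl.
have S0 : 0 < S (expR (expR (expR v))) by apply: lt_le_trans hl; exact: expR_gt0.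
have wv : expR (expR v) / expR v * v != 0.
  by rewrite gt_eqF// mulr_gt0 ?divr_gt0 ?expR_gt0//; lra.
rewrite L_expR3 -!expRM !expRK [2 * beta + _]addrC subrK.
by rewrite [_ * beta]mulrC [X in _ / expR X]mulrC divfK// -expRB subKr lnK.
Qed.
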